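(* Let $n\ge 2$. Let $A=(\langle\alpha_i,\alpha_j\rangle)_{1\le i,j\le n-1}$ be the Cartan matrix of type $A_{n-1}$, i.e. $\langle\alpha_i,\alpha_j\rangle=2$ if $i=j$, $-1$ if $|i-j|=1$, and $0$ otherwise. Let ${\bf m}=(m_{i,j})_{1\le i<j\le n}$ denote a tuple of non-negative integers, and set $$\lambda_i=\lambda_i({\bf m})=\sum_{1\le s\le i,\; i<\ell\le n} m_{s,\ell},\qquad 1\le i\le n-1 .$$ (a) As formal power series in $q,x_1,\dots,x_{n-1}$, $$\sum_{{\bf m}\in\mathbb{Z}_{\ge 0}^{n(n-1)/2}}\frac{q^{B({\bf m})}x_1^{\lambda_1}\cdots x_{n-1}^{\lambda_{n-1}}}{\prod_{1\le i<j\le n}(q)_{m_{i,j}}}=\sum_{{\bf k}=(k_1,\dots,k_{n-1})\in\mathbb{Z}_{\ge 0}^{n-1}}\frac{q^{\frac12{\bf k}A{\bf k}^{\top}}x_1^{k_1}\cdots x_{n-1}^{k_{n-1}}}{(q)_{k_1}(q)_{k_2}\cdots(q)_{k_{n-1}}},$$ where $$B({\bf m})=\sum_{\substack{1\le i_1<j_1\le n\\ 1\le i_2<j_2\le n\\ i_1<i_2,\ j_1<j_2\\ j_1>i_2+1}}m_{i_1,j_1}m_{i_2,j_2}+\sum_{\substack{1\le i_1<j_1\le n\\ 1\le i_2<j_2\le n\\ i_1=i_2,\ j_1\le j_2}}m_{i_1,j_1}m_{i_2,j_2}+\sum_{\substack{1\le i_1<j_1\le n\\ 1\le i_2<j_2\le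 n\\ j_1=j_2,\ i_1<i_2}}m_{i_1,j_1}m_{i_2,j_2}+\sum_{1\le j<i<i+1<j'\le n}m_{i,i+1}m_{j,j'} .$$ (b) As formal power series in $q,x_1,\dots,x_{n-1}$, $$\sum_{{\bf m}\in\mathbb{Z}_{\ge 0}^{n(n-1)/2}}\frac{q^{B'({\bf m})}x_1^{\lambda_1}\cdots x_{n-1}^{\lambda_{n-1}}}{\prod_{1\le i<j\le n}(q)_{m_{i,j}}}=\sum_{{\bf k}\in\mathbb{Z}_{\ge 0}^{n-1}}\frac{q^{\frac12{\bf k}A{\bf k}^{\top}}x_1^{k_1}\cdots x_{n-1}^{k_{n-1}}}{(q)_{k_1}(q)_{k_2}\cdots(q)_{k_{n-1}}},$$ where $$B'({\bf m})=\sum_{\substack{1\le i_1<j_1\le n\\ 1\le i_2<j_2\le n\\ i_1\le i_2,\ j_1\le j_2\\ j_1>i_2}}m_{i_1,j_1}m_{i_2,j_2}.$$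
   Context: Notation: $(q)_k=\prod_{i=1}^{k}(1-q^i)$ for $k\ge 0$, with $(q)_0=1$; $1/(q)_k$ is expanded as a power series in $q$. Each sum in $B$, $B'$ runs over ordered index data $((i_1,j_1),(i_2,j_2))$ satisfying the listed conditions. *)

(* Defs.v *)
From HB Require Import structures.
From mathcomp Require Import all_boot all_order all_algebra.
From mathcomp Require Import boolp classical_sets functions cardinality fsbigop.
From mathcomp Require Import ring zify.

Set Implicit Arguments.
Unset Strict Implicit.
Unset Printing Implicit Defensive.

Import Order.TTheory GRing.Theory Num.Theory.
Local Open Scope ring_scope.

(* R[[q]], as a commutative ring with the Cauchy product. *)
Record fps (R : Type) := Fps { fcoef : nat -> R }.

HB.instance Definition _ (R : Type) := gen_eqMixin (fps R).
HB.instance Definition _ (R : Type) := gen_choiceMixin (fps R).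

Lemma fpsP (R : Type) (f g : fps R) : fcoef f =1 fcoef g -> f = g.
Proof. by case: f g => [f] [g] /= /funext->. Qed.

Section FpsRing.
Variable R : comUnitRingType.
Implicit Types f g h : fps R.

Definition fps_zero : fps R := Fps (fun=> 0).
Definition fps_opp f := Fps (fun n => - fcoef f n).
Definition fps_add f g := Fps (fun n => fcoef f n + fcoef g n).
Definition fps_one : fps R := Fps (fun n => (n == 0%N)%:R).
Definition fps_mul f g :=
  Fps (fun n => \sum_(i < n.+1) fcoef f i * fcoef g (n - i)%N).

Fact fps_addA : associative fps_add.
Proof. by move=> f g h; apply: fpsP => n /=; rewrite addrA. Qed.
Fact fps_addC : commutative fps_add.
Proof. by move=> f g; apply: fpsP => n /=; rewrite addrC. Qed.
Fact fps_add0 : left_id fps_zero fps_add.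
Proof. by move=> f; apply: fpsP => n /=; rewrite add0r. Qed.
Fact fps_addN : left_inverse fps_zero fps_opp fps_add.
Proof. by move=> f; apply: fpsP => n /=; rewrite addNr. Qed.

HB.instance Definition _ :=
  GRing.isZmodule.Build (fps R) fps_addA fps_addC fps_add0 fps_addN.

Definition fps_trunc n f : {poly R} := \poly_(i < n) fcoef f i.

Fact fcoef_mul_trunc f g n N : (n < N)%N ->
  fcoef (fps_mul f g) n = (fps_trunc N f * fps_trunc N g)`_n.
Proof.
move=> nN; rewrite coefM; apply: eq_bigr => i _; rewrite !coef_poly.
rewrite (leq_ltn_trans _ nN); last by rewrite -ltnS ltn_ord.
by rewrite (leq_ltn_trans (leq_subr _ _) nN).
Qed.

Fact fps_mulC : commutative fps_mul.
Proof.
by move=> f g; apply: fpsP => n; rewrite !(@fcoef_mul_trunc _ _ n n.+1) // mulrC.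
Qed.

Fact fps_mulA : associative fps_mul.
Proof.
move=> f g h; apply: fpsP => n.
transitivity ((fps_trunc n.+1 f * (fps_trunc n.+1 g * fps_trunc n.+1 h))`_n).
  rewrite coefM; apply: eq_bigr => i _; rewrite coef_poly ltn_ord.
  by rewrite (@fcoef_mul_trunc g h _ n.+1) // ltnS leq_subr.
rewrite mulrA coefM; apply: eq_bigr => i _.
by rewrite coef_poly ltnS leq_subr -fcoef_mul_trunc.
Qed.

Fact fps_mul1 : left_id fps_one fps_mul.
Proof.
move=> f; apply: fpsP => n /=; rewrite big_ord_recl /= mul1r subn0.
by rewrite big1 ?addr0 // => i _; rewrite mul0r.
Qed.

Fact fps_mulDl : left_distributive fps_mul fps_add.
Proof.
move=> f g h; apply: fpsP => n /=; rewrite -big_split /=.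
by apply: eq_bigr => i _; rewrite mulrDl.
Qed.

Fact fps_one_neq0 : fps_one != 0.
Proof.
by apply/eqP => /(congr1 (fun f => fcoef f 0)) /= /eqP; rewrite oner_eq0.
Qed.

HB.instance Definition _ := GRing.Zmodule_isComNzRing.Build (fps R)
  fps_mulA fps_mulC fps_mul1 fps_mulDl fps_one_neq0.

Lemma fcoef0 n : fcoef (0 : fps R) n = 0. Proof. by []. Qed.
Lemma fcoef1 n : fcoef (1 : fps R) n = (n == 0%N)%:R. Proof. by []. Qed.
Lemma fcoefN f n : fcoef (- f) n = - fcoef f n. Proof. by []. Qed.
Lemma fcoefD f g n : fcoef (f + g) n = fcoef f n + fcoef g n.
Proof. by []. Qed.
Lemma fcoefM f g n :
  fcoef (f * g) n = \sum_(i < n.+1) fcoef f i * fcoef g (n - i)%N.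
Proof. by []. Qed.

(* A series is invertible iff its constant coefficient is; the coefficients of
   the inverse are then forced by the recursion below. *)
Fixpoint fps_invseq f n : seq R :=
  if n is n'.+1 then
    let s := fps_invseq f n' in
    rcons s (if n' is 0%N then (fcoef f 0)^-1
             else - (fcoef f 0)^-1 * \sum_(i < n') s`_i * fcoef f (n' - i)%N)
  else [::].

Definition fps_unit : pred (fps R) := fun f => fcoef f 0 \is a GRing.unit.
Definition fps_inv f :=
  if fps_unit f then Fps (fun n => (fps_invseq f n.+1)`_n) else f.

Fact size_fps_invseq f n : size (fps_invseq f n) = n.
Proof. by elim: n => //= n IHn; rewrite size_rcons IHn. Qed.

Fact nth_fps_invseq f n m : (m < n)%N ->
  (fps_invseq f n)`_m = (fps_invseq f m.+1)`_m.
Proof.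
elim: n => // n IHn; rewrite ltnS leq_eqVlt => /orP[/eqP-> //|mn].
by rewrite -(IHn mn) [in LHS]/= nth_rcons size_fps_invseq mn.
Qed.

Fact fps_mulVr : {in fps_unit, left_inverse 1 fps_inv *%R}.
Proof.
move=> f fU; have uf : fcoef f 0 \is a GRing.unit by [].
apply: fpsP => n; rewrite fcoefM fcoef1 big_ord_recr /= subnn.
rewrite /fps_inv (_ : fps_unit f = true) //.
set inv := Fps _; have invE m : fcoef inv m = (fps_invseq f m.+1)`_m by [].
rewrite (invE n) /= nth_rcons size_fps_invseq ltnn eqxx.
case: n => [|n]; first by rewrite big_ord0 add0r mulVr.
rewrite mulrAC mulNr mulVr // mulN1r.
apply/eqP; rewrite subr_eq0; apply/eqP; apply: eq_bigr => i _.
by congr (_ * _); apply/esym/(@nth_fps_invseq f n.+1 i).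
Qed.

Fact fps_unitP f g : g * f = 1 -> fps_unit f.
Proof.
move=> /(congr1 (fun f => fcoef f 0)); rewrite fcoefM fcoef1 big_ord1 /= => gf.
by apply/unitrP; exists (fcoef g 0); split; last rewrite mulrC.
Qed.

Fact fps_invr_out : {in [predC fps_unit], fps_inv =1 id}.
Proof. by move=> f; rewrite /fps_inv; case: ifP => // fU /negP[]. Qed.

HB.instance Definition _ := GRing.ComNzRing_hasMulInverse.Build (fps R)
  fps_mulVr fps_unitP fps_invr_out.

Lemma fps_unitE f : (f \is a GRing.unit) = (fcoef f 0 \is a GRing.unit).
Proof. by []. Qed.

End FpsRing.

Definition qvar : fps int := Fps (fun n => (n == 1%N)%:R).

Definition qpoch (k : nat) : fps int := \prod_(1 <= i < k.+1) (1 - qvar ^+ i).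

Lemma qpoch_unit k : qpoch k \is a GRing.unit.
Proof.
rewrite /qpoch big_seq; apply: rpred_prod => i.
rewrite mem_index_iota => /andP[i_gt0 _]; rewrite fps_unitE fcoefD fcoefN fcoef1.
case: i i_gt0 => // i _; rewrite exprS fcoefM big_ord1 /= mul0r subr0.
exact: unitr1.
Qed.

(* Z[[q, x_0, ..., x_(d-1)]], seen as the families of coefficients in Z[[q]]
   of the monomials x^e. *)
Definition xseries (d : nat) := {ffun 'I_d -> nat} -> fps int.

Definition xmonom (d : nat) (c : fps int) (e : {ffun 'I_d -> nat}) :
  xseries d := fun e' => if e' == e then c else 0.

(* A family of formal power series is summable when every monomial q^a x^e
   occurs in only finitely many members; the sum is then coefficientwise. *)
Definition xsummable (d : nat) (I : choiceType) (F : I -> xseries d) : Prop :=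
  forall (e : {ffun 'I_d -> nat}) (a : nat),
    finite_set [set i | fcoef (F i e) a != 0].

Definition xsum (d : nat) (I : choiceType) (F : I -> xseries d) : xseries d :=
  fun e => Fps (fun a => \sum_(i \in [set: I]) fcoef (F i e) a).

(* The index pairs (i, j) with i < j.  All indices are 0-based: i, j range over
   0..n-1, the variables x_i and the exponents k_i, lambda_i over 0..n-2. *)
Definition ipair (n : nat) : finType := {p : 'I_n * 'I_n | (p.1 < p.2)%N}.

Definition fst_ix (n : nat) (p : ipair n) : nat := (val p).1.
Definition snd_ix (n : nat) (p : ipair n) : nat := (val p).2.

Definition mtuple (n : nat) : choiceType := {ffun ipair n -> nat}.

Definition lambda (n : nat) (m : mtuple n) : {ffun 'I_n.-1 -> nat} :=
  [ffun i : 'I_n.-1 => (\sum_(p : ipair n | fst_ix p <= i < snd_ix p) m p)%N].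

Definition Bform (n : nat) (m : mtuple n) : nat :=
  (\sum_(p : ipair n) \sum_(r : ipair n |
      [&& fst_ix p < fst_ix r, snd_ix p < snd_ix r
        & snd_ix p > (fst_ix r).+1]) m p * m r
   + \sum_(p : ipair n) \sum_(r : ipair n |
      (fst_ix p == fst_ix r) && (snd_ix p <= snd_ix r)) m p * m r
   + \sum_(p : ipair n) \sum_(r : ipair n |
      (snd_ix p == snd_ix r) && (fst_ix p < fst_ix r)) m p * m r
   + \sum_(p : ipair n | snd_ix p == (fst_ix p).+1)
       \sum_(r : ipair n |
         (fst_ix r < fst_ix p) && ((fst_ix p).+1 < snd_ix r)) m p * m r)%N.

Definition Bform' (n : nat) (m : mtuple n) : nat :=
  (\sum_(p : ipair n) \sum_(r : ipair n |
      [&& fst_ix p <= fst_ix r, snd_ix p <= snd_ix r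
        & snd_ix p > fst_ix r]) m p * m r)%N.

Definition cartanA (d : nat) : 'M[int]_d :=
  \matrix_(i, j) (if i == j then 2
                  else if (i.+1 == j :> nat) || (j.+1 == i :> nat) then -1
                  else 0).

Definition cartan_form (d : nat) (k : {ffun 'I_d -> nat}) : int :=
  let v : 'rV[int]_d := \row_i (k i)%:Z in (v *m cartanA d *m v^T) 0 0.

(* The division and the absolute value are exact: see half_cartan_formE. *)
Definition half_cartan_form (d : nat) (k : {ffun 'I_d -> nat}) : nat :=
  `|(cartan_form k %/ 2)%Z|%N.

Definition m_term (n : nat) (Q : mtuple n -> nat) (m : mtuple n) :
  xseries n.-1 :=
  xmonom (qvar ^+ Q m / \prod_(p : ipair n) qpoch (m p)) (lambda m).

Definition k_term (d : nat) (k : {ffun 'I_d -> nat}) : xseries d :=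
  xmonom (qvar ^+ half_cartan_form k / \prod_(i < d) qpoch (k i)) k.

Lemma cartan_formE (d : nat) (k : {ffun 'I_d -> nat}) :
  cartan_form k = \sum_(i < d) \sum_(j < d) (k i)%:Z * cartanA d i j * (k j)%:Z.
Proof.
rewrite /cartan_form mxE exchange_big /=; apply: eq_bigr => j _.
by rewrite !mxE mulr_suml; apply: eq_bigr => i _; rewrite !mxE.
Qed.

Section CartanForm.
Variable K : nat -> int.

Let a (i j : nat) : int :=
  if i == j then 2 else if (i.+1 == j) || (j.+1 == i) then -1 else 0.
Let S d := \sum_(i < d) \sum_(j < d) K i * a i j * K j.

Let S1 : S 1 = 2 * K 0 ^+ 2.
Proof. by rewrite /S !big_ord1 /a eqxx; ring. Qed.

Let SS d : S d.+2 = S d.+1 + 2 * (K d.+1 ^+ 2 - K d * K d.+1).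
Proof.
have cross (F : nat -> int) :
    (forall i, (i < d)%N -> F i = 0) -> \sum_(i < d.+1) F i = F d.
  by move=> F0; rewrite big_ord_recr /= big1 ?add0r // => i _; exact: F0.
rewrite {1}/S big_ord_recr /=.
under eq_bigr do rewrite big_ord_recr /=.
rewrite big_split /= -/(S d.+1) [X in _ + _ + X = _]big_ord_recr /=.
rewrite (cross (fun i => K i * a i d.+1 * K d.+1)); last first.
  by move=> i id; rewrite /a !(fun_if, if_arg) eqSS; do ?case: ifP => //; lia.
rewrite [X in _ + (X + _)](cross (fun j => K d.+1 * a d.+1 j * K j)); last first.
  by move=> i id; rewrite /a; do ?case: ifP => //; lia.
have -> : a d d.+1 = -1 by rewrite /a eqxx; case: eqP => //; lia.
have -> : a d.+1 d = -1 by rewrite /a eqxx orbT; case: eqP => //; lia.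
have -> : a d.+1 d.+1 = 2 by rewrite /a eqxx.
by ring.
Qed.

Let S_ge d : K d ^+ 2 <= S d.+1.
Proof.
elim: d => [|d IHd]; first by rewrite S1 mulr_natl mulr2n lerDl sqr_ge0.
rewrite SS -subr_ge0.
have -> : S d.+1 + 2 * (K d.+1 ^+ 2 - K d * K d.+1) - K d.+1 ^+ 2 =
  (S d.+1 - K d ^+ 2) + (K d.+1 - K d) ^+ 2 by ring.
by rewrite addr_ge0 ?sqr_ge0 ?subr_ge0.
Qed.

Fact cartan_sum_even_ge0 d : exists N : nat,
  \sum_(i < d) \sum_(j < d) K i * a i j * K j = N%:Z * 2.
Proof.
rewrite -/(S d); have : exists z, S d = z * 2.
  case: d => [|d]; first by exists 0; rewrite /S big_ord0 mul0r.
  elim: d => [|d [z zE]]; first by exists (K 0 ^+ 2); rewrite S1 mulrC.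
  by exists (z + (K d.+1 ^+ 2 - K d * K d.+1)); rewrite SS zE; ring.
move=> [z zE]; have : 0 <= S d.
  case: d zE => [|d] _; first by rewrite /S big_ord0.
  by apply: le_trans (S_ge d); rewrite sqr_ge0.
by case: z zE => N ->; [exists N | lia].
Qed.

End CartanForm.

Lemma half_cartan_formE (d : nat) (k : {ffun 'I_d -> nat}) :
  (half_cartan_form k)%:Z * 2 = cartan_form k.
Proof.
pose K i : int := if insub i is Some j then (k j)%:Z else 0.
have [N NE] := cartan_sum_even_ge0 K d.
rewrite /half_cartan_form; suff -> : cartan_form k = N%:Z * 2.
  by rewrite mulzK // absz_nat.
rewrite -NE cartan_formE; apply: eq_bigr => i _; apply: eq_bigr => j _.
by rewrite /K !valK mxE.
Qed.

(* Main.v *)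
Require Import Defs.
From HB Require Import structures.
From mathcomp Require Import all_boot all_order all_algebra.
From mathcomp Require Import boolp classical_sets functions cardinality fsbigop.
From mathcomp Require Import ring zify.

Set Implicit Arguments.
Unset Strict Implicit.
Unset Printing Implicit Defensive.

Import Order.TTheory GRing.Theory Num.Theory.
Local Open Scope ring_scope.

(* Put N m := B m - half_cartan_form (lambda m).  The claim is that for each k the
   sum of q^(N m) / prod (q)_(m_p) over the m with lambda m = k is
   1 / prod (q)_(k_i).  View the pairs (i, j) as the positive roots
   alpha_i + ... + alpha_(j-1) of A_(n-1).  If al + si = ga are roots, the pentagon
   identity
     sum_c q^((a-c)(b-c)) / ((q)_(a-c) (q)_(b-c) (q)_c) = 1 / ((q)_a (q)_b)
   replaces the multiplicities a, b of al, si by a - c, b - c and a multiplicity c of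
   ga.  Starting from the simple roots with multiplicities k, one creates all roots
   (i, j + 1) by merging (i, j) with (j, j + 1), for increasing j and, for fixed j,
   with i in an arbitrary order rho_j.  The resulting exponent N depends on the
   orders; the natural order gives B' and the order j-1, 0, 1, ..., j-2 gives B. *)

(** * The pentagon identity *)

Lemma qpochS k : qpoch k.+1 = qpoch k * (1 - qvar ^+ k.+1).
Proof. by rewrite /qpoch big_nat_recr. Qed.

Lemma subr1_qvarX_unit k : 1 - qvar ^+ k.+1 \is a GRing.unit.
Proof. by have := qpoch_unit k.+1; rewrite qpochS unitrM => /andP[]. Qed.

Lemma qpochV_pred k : (1 - qvar ^+ k.+1) / qpoch k.+1 = (qpoch k)^-1.
Proof.
by rewrite qpochS invrM ?qpoch_unit ?subr1_qvarX_unit// mulrA divrr ?mul1r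
  ?subr1_qvarX_unit.
Qed.

(** The guard removes the range where natural subtraction would truncate, so the recursion in a
    holds for all c and any large summation bound will do. *)
Definition pentagon_term (a b c : nat) : fps int :=
  if (c <= a)%N && (c <= b)%N then
    qvar ^+ ((a - c) * (b - c))%N / (qpoch (a - c) * qpoch (b - c) * qpoch c)
  else 0.

Lemma qpochM3V a b c : (qpoch a * qpoch b * qpoch c)^-1 =
  (qpoch a)^-1 * (qpoch b)^-1 * (qpoch c)^-1.
Proof. by rewrite !invrM ?unitrM ?qpoch_unit// mulrC [X in X * _]mulrC. Qed.

(* (1 - q^(a+1)) = (1 - q^c) + q^c (1 - q^(a+1-c)), each part cancelling one of
   the factors of the denominator. *)
Lemma pentagon_termS a b c :
  (1 - qvar ^+ a.+1) * pentagon_term a.+1 b c =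
  (if c is c'.+1 then if b is b'.+1 then pentagon_term a b' c' else 0 else 0)
  + qvar ^+ b * pentagon_term a b c.
Proof.
rewrite /pentagon_term !qpochM3V.
case: (leqP c b) => [cb|bc]; last first.
  rewrite !andbF !mulr0 addr0; case: c bc => // c; case: b => // b bc.
  by case: ifP => //; lia.
rewrite !andbT; case: (leqP c a.+1) => [ca|ac]; last first.
  rewrite [(c <= a)%N]leqNgt (ltnW ac) /= !mulr0 addr0.
  by case: c ac {cb} => // c ac; case: b => // b; case: ifP => //; lia.
have -> : 1 - qvar ^+ a.+1 =
    (1 - qvar ^+ c) + qvar ^+ c * (1 - qvar ^+ (a.+1 - c)).
  by rewrite mulrBr mulr1 -exprD subnKC // addrA subrK.
rewrite mulrDl; congr (_ + _).
  case: c cb ca => [|c] cb ca; first by rewrite subrr mul0r.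
  case: b cb => // b cb.
  rewrite -![(c < _.+1)%N]/(c <= _)%N in ca cb.
  rewrite ca cb !subSS qpochM3V -(qpochV_pred c) /=; ring.
case: (ltngtP c a.+1) ca => // [ca|->] _; last first.
  by rewrite subnn subrr mulr0 mul0r leqNgt leqnn mulr0.
rewrite -ltnS ca subSn // -(qpochV_pred (a - c)).
rewrite (_ : qvar ^+ b = qvar ^+ c * qvar ^+ (b - c)); last first.
  by rewrite -exprD subnKC.
by rewrite mulSn exprD; ring.
Qed.

(** Induction on a, with b and the summation bound free. After multiplication by the unit 1 -
    q^(a+1), [pentagon_termS] gives 1/((q)_a (q)_(b-1)) + q^b/((q)_a (q)_b), and 1/(q)_(b-1) = (1 -
    q^b)/(q)_b; for b = 0 the first summand is absent. *)
Lemma pentagon_sum a b :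
  \sum_(0 <= c < (minn a b).+1)
     qvar ^+ ((a - c) * (b - c))%N / (qpoch (a - c) * qpoch (b - c) * qpoch c)
  = (qpoch a)^-1 * (qpoch b)^-1.
Proof.
suff H M : (a < M)%N ->
    \sum_(0 <= c < M) pentagon_term a b c = (qpoch a)^-1 * (qpoch b)^-1.
  rewrite -(H a.+1) // [RHS](big_cat_nat (n := (minn a b).+1)) //=; last first.
    exact: geq_minl.
  rewrite [X in _ = _ + X]big_nat [X in _ = _ + X]big1 ?addr0; last first.
    by move=> c; rewrite gtn_min /pentagon_term => /andP[h1 h2]; case: ifP => //; lia.
  apply: eq_big_nat => c; rewrite ltnS leq_min /= => h.
  by rewrite /pentagon_term h.
elim: a b M => [|a IHa] b [//|M] aM.
  rewrite big_nat_recl // big1 ?addr0 /pentagon_term /=; last by [].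
  rewrite subn0 mul0n expr0 !subn0 qpochM3V /qpoch big_geq // invr1.
  by rewrite !mul1r mulr1.
apply: (mulrI (subr1_qvarX_unit a)).
rewrite mulr_sumr; under eq_bigr do rewrite pentagon_termS.
rewrite big_split -mulr_sumr IHa; last exact: ltnW.
rewrite [RHS]mulrA qpochV_pred big_nat_recl //= add0r.
case: b => [|b].
  by rewrite big1 // add0r mul1r.
by rewrite (IHa b M) // -(qpochV_pred b); ring.
Qed.

(** * The pentagon move on weighted sums over multiplicities *)

Definition qweight (P : finType) (N : nat) (m : {ffun P -> nat}) : fps int :=
  qvar ^+ N / \prod_(p : P) qpoch (m p).

Definition supported (P : finType) (S : pred P) (m : {ffun P -> nat}) : bool :=
  [forall p, (m p != 0%N) ==> S p].

Lemma supportedP (P : finType) (S : pred P) (m : {ffun P -> nat}) :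
  reflect (forall p, ~~ S p -> m p = 0%N) (supported S m).
Proof.
apply: (iffP forallP) => h p; last by apply/implyP; apply: contraR => /h ->.
by move=> nSp; apply/eqP; apply: contraR nSp; apply/implyP.
Qed.

Section PentagonMove.
(* Think of positive roots [ga = al + si]. *)
Variables (P : finType) (al si ga : P).
Hypotheses (al_si : al != si) (al_ga : al != ga) (si_ga : si != ga).
Implicit Types m : {ffun P -> nat}.

(** Dissolves ga, returning its multiplicity to al and si. If m ga = 0, the tuples that merge to m
    are the [unmerge m c] with c <= min(m al, m si). *)
Definition merge m : {ffun P -> nat} := [ffun p =>
  if p == ga then 0%N else if (p == al) || (p == si) then (m p + m ga)%N
  else m p].

Definition unmerge m c : {ffun P -> nat} := [ffun p =>
  if p == ga then c else if (p == al) || (p == si) then (m p - c)%N else m p].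

Lemma mergeK m : unmerge (merge m) (m ga) = m.
Proof.
apply/ffunP => p; rewrite !ffunE; case: eqP => [->//|_].
by case: orb => //; rewrite addnK.
Qed.

Lemma unmergeK m c : m ga = 0%N -> (c <= m al)%N -> (c <= m si)%N ->
  merge (unmerge m c) = m.
Proof.
move=> m0 cal csi; apply/ffunP => p; rewrite !ffunE eqxx.
case: (p =P ga) => [->//|_].
by case E: orb => //; case/orP: E => /eqP->; exact: subnK.
Qed.

(** The indicator of Q is additive along ga = al + si, so the move preserves the sum. The entries of
    [lambda] and the rows of the exponent are such sums. *)
Lemma sum_merge_pred (Q : pred P) m : (Q al + Q si = Q ga :> nat)%N ->
  (\sum_(p | Q p) merge m p = \sum_(p | Q p) m p)%N.
Proof.
move=> QE.
have sum1 x y : (\sum_(p | Q p) (p == x) * y = Q x * y)%N.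
  rewrite big_mkcond (bigD1 x) //= eqxx mul1n big1 => [|p /negPf->].
    by rewrite addn0; case: ifP => _; rewrite ?mul1n ?mul0n.
  by rewrite mul0n if_same.
(* Adding Q ga * m ga on both sides avoids subtraction and leaves a termwise identity. *)
apply/eqP; rewrite -(eqn_add2r (Q ga * m ga)) -{2}QE mulnDl -!sum1 -!big_split /=.
apply/eqP/eq_bigr => p _; rewrite !ffunE.
case: (p =P ga) => [->|_].
  by rewrite ![ga == _]eq_sym (negPf al_ga) (negPf si_ga) /=; lia.
case: (p =P al) => [->|_]; first by rewrite (negPf al_si) /=; lia.
by case: (p == si); rewrite /=; lia.
Qed.

Lemma qpoch_prod3 m : \prod_(p : P) qpoch (m p) =
  qpoch (m al) * qpoch (m si) * qpoch (m ga) *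
  \prod_(p | (p != ga) && ((p != al) && (p != si))) qpoch (m p).
Proof.
rewrite (bigD1 al) //= (bigD1 si) 1?eq_sym //= (bigD1 ga) /=; last first.
  by rewrite eq_sym al_ga eq_sym.
by rewrite !mulrA; congr (_ * _); apply: eq_bigl => p; rewrite andbC.
Qed.

Lemma unit_prod_qpoch (Q : pred P) m :
  \prod_(p | Q p) qpoch (m p) \is a GRing.unit.
Proof. by apply: rpred_prod => p _; exact: qpoch_unit. Qed.

Lemma sum_unmerge m N : m ga = 0%N ->
  \sum_(0 <= c < (minn (m al) (m si)).+1)
     qweight (N + (m al - c) * (m si - c)) (unmerge m c) = qweight N m.
Proof.
move=> m0; rewrite /qweight qpoch_prod3 m0.
rewrite [qpoch 0]/qpoch big_geq // mulr1 !invrM ?unitrM ?qpoch_unit ?unit_prod_qpoch //.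
rewrite [_ / qpoch (m al)]mulrC -pentagon_sum !mulr_sumr.
apply: eq_bigr => c _; rewrite qpoch_prod3 !ffunE.
rewrite (negPf al_ga) (negPf si_ga) !eqxx orbT /=.
rewrite invrM ?unitrM ?qpoch_unit ?unit_prod_qpoch //.
rewrite (eq_bigr (fun p => qpoch (m p))) => [|p /and3P[/negPf pg /negPf pa /negPf ps]].
  by rewrite exprD; ring.
by rewrite !ffunE pg pa ps.
Qed.

(** Grouping the left sum by [merge m] turns each group into the sum of [sum_unmerge]: after
    unmerging, m al and m si are the a - c and b - c of the pentagon identity. The list [L] is a
    finite union of such groups. *)
Lemma sum_merge (L : seq {ffun P -> nat}) (S S' : pred P)
    (N N' : {ffun P -> nat} -> nat) :
  uniq L -> (forall m, (merge m \in L) = (m \in L)) ->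
  S al -> S si -> ~~ S ga -> (forall p, S' p = S p || (p == ga)) ->
  (forall m, supported S' m -> N' m = (N (merge m) + m al * m si)%N) ->
  \sum_(m <- L | supported S' m) qweight (N' m) m =
  \sum_(m <- L | supported S m) qweight (N m) m.
Proof.
move=> uL mL Sal Ssi Sga S'E NE.
have supp_merge m : supported S' m -> supported S (merge m).
  move=> /supportedP h; apply/supportedP => p Sp; rewrite ffunE.
  case: eqP => // /eqP pga; case: ifP => [|_]; last first.
    by apply: h; rewrite S'E (negPf Sp).
  by case/orP => /eqP pE; move: Sp; rewrite pE ?Sal ?Ssi.
transitivity (\sum_(m <- L | supported S' m)
    \sum_(m' <- L | supported S m' && (m' == merge m)) qweight (N' m) m).
  rewrite big_seq_cond [RHS]big_seq_cond.
  apply: eq_bigr => m /andP[mIn Sm].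
  rewrite (big_rem (merge m)) /= ?mL // eqxx supp_merge //.
  rewrite big_seq_cond big1 ?addr0 // => m' /and3P[m'L _ /eqP m'E].
  by move: m'L; rewrite m'E mem_rem_uniqF.
rewrite (exchange_big_dep (supported S)) /=; last by move=> m m' _ /andP[].
rewrite big_seq_cond [RHS]big_seq_cond; apply: eq_bigr => m /andP[mIn Sm].
have m0 : m ga = 0%N by move/supportedP: Sm; apply.
rewrite -(sum_unmerge (N m) m0) -big_filter.
(* The group over m is parametrised by the multiplicity c of ga. *)
rewrite (perm_big [seq unmerge m c | c <- index_iota 0 (minn (m al) (m si)).+1]).
  rewrite big_map; apply: eq_big_nat => c /=; rewrite ltnS leq_min => /andP[ca cs].
  rewrite NE ?unmergeK //.
    by rewrite !ffunE (negPf al_ga) (negPf si_ga) !eqxx orbT.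
  apply/supportedP => p; rewrite S'E negb_or => /andP[Sp pga].
  rewrite ffunE (negPf pga); case: ifP => [/orP[]/eqP pE|_].
  - by move: Sp; rewrite pE Sal.
  - by move: Sp; rewrite pE Ssi.
  - by move/supportedP: Sm; apply.
apply: uniq_perm; first exact: filter_uniq.
  rewrite map_inj_uniq ?iota_uniq // => c d /ffunP/(_ ga).
  by rewrite !ffunE eqxx.
move=> m1; rewrite mem_filter; apply/idP/mapP => [/andP[/and3P[Sm1 _ /eqP mE] m1L]|].
  exists (m1 ga); last by rewrite mE mergeK.
  rewrite mem_index_iota ltnS leq_min mE !ffunE (negPf al_ga) (negPf si_ga).
  by rewrite !eqxx orbT !leq_addl.
move=> [c]; rewrite mem_index_iota ltnS leq_min => /= /andP[ca cs] ->.
rewrite -mL unmergeK //; rewrite mIn Sm eqxx !andbT.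
apply/supportedP => p; rewrite S'E negb_or => /andP[Sp pga].
rewrite ffunE (negPf pga); case: ifP => [/orP[]/eqP pE|_].
- by move: Sp; rewrite pE Sal.
- by move: Sp; rewrite pE Ssi.
- by move/supportedP: Sm; apply.
Qed.

End PentagonMove.

(** * Creating the roots in order *)

Lemma ipair_lt n (p : ipair n) : (fst_ix p < snd_ix p)%N.
Proof. exact: (valP p). Qed.

Lemma snd_ix_lt n (p : ipair n) : (snd_ix p < n)%N.
Proof. exact: ltn_ord. Qed.

Lemma ipair_inj n (p r : ipair n) :
  fst_ix p = fst_ix r -> snd_ix p = snd_ix r -> p = r.
Proof.
case: p r => [[i j] ij] [[a b] ab]; rewrite /fst_ix /snd_ix /= => ia jb.
by apply/val_inj; congr (_, _); apply/val_inj.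
Qed.

Lemma ipair_exists n i j : (i < j)%N -> (j < n)%N ->
  exists2 p : ipair n, fst_ix p = i & snd_ix p = j.
Proof.
move=> ij jn; have iN : (i < n)%N by apply: ltn_trans jn.
by exists (Sub (Ordinal iN, Ordinal jn) ij).
Qed.

Definition simple n (p : ipair n) : bool := snd_ix p == (fst_ix p).+1.

Section OrderedForm.
(* For each j, the values [rho j i], i < j, are the ranks in which the merges of
   (i, j) with (j, j + 1) are performed; [rho j j] only has to be the largest. *)
Variables (n : nat) (rho : nat -> nat -> nat).
Hypothesis rho_inj : forall j i a, (i <= j)%N -> (a <= j)%N ->
  rho j i = rho j a -> i = a.
Hypothesis rho_lt : forall j i, (i < j)%N -> (rho j i < rho j j)%N.
Hypothesis rho_le : forall j, (rho j j <= j.+1)%N.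

Definition above (p r : ipair n) : bool :=
  [&& snd_ix p < snd_ix r, fst_ix r <= snd_ix p
    & rho (snd_ix p) (fst_ix p) < rho (snd_ix p) (fst_ix r)]%N.

Definition ordered_form (m : mtuple n) : nat :=
  (\sum_(p : ipair n) \sum_(r : ipair n | above p r) m p * m r)%N.

(* Encodes the lexicographic order on (j, rho (j - 1) i); the interval (i, j) is
   obtained by merging (i, j - 1) with (j - 1, j). *)
Definition creation_time (j i : nat) : nat := (j * n.+2 + rho j.-1 i)%N.

Lemma rho_bound j i : (i < j)%N -> (rho j.-1 i <= j)%N.
Proof.
case: j => // j; rewrite ltnS leq_eqVlt => /orP[/eqP->|/rho_lt/ltnW ij] //=.
exact: leq_trans ij _.
Qed.

Lemma creation_time_lt j i b a : (i < j <= n)%N -> (a < b <= n)%N ->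
  (creation_time j i < creation_time b a)%N =
  (j < b)%N || (j == b) && (rho j.-1 i < rho j.-1 a)%N.
Proof.
move=> /andP[ij jn] /andP[ab bn]; rewrite /creation_time.
have := rho_bound ij; have := rho_bound ab.
case: (ltngtP j b) => [jb|bj|<-] /= r1 r2; last by rewrite ltn_add2l.
  by have := leq_mul2r n.+2 j.+1 b; rewrite jb orbT mulSn; lia.
by have := leq_mul2r n.+2 b.+1 j; rewrite bj orbT mulSn; lia.
Qed.

Lemma creation_time_inj j i b a : (i < j <= n)%N -> (a < b <= n)%N ->
  creation_time j i = creation_time b a -> i = a /\ j = b.
Proof.
move=> ij ab e.
have := creation_time_lt ij ab; have := creation_time_lt ab ij.
rewrite e ltnn; case: (ltngtP j b) => //= jb; rewrite -jb in ab * => h1 h2.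
by split=> //; apply: (@rho_inj j.-1); lia.
Qed.

Lemma creation_time_bound j i : (i < j <= n)%N ->
  (creation_time j i < n.+1 * n.+2)%N.
Proof.
move=> /andP[ij jn]; rewrite /creation_time; have := rho_bound ij.
by have := leq_mul2r n.+2 j n; rewrite jn orbT mulSn; lia.
Qed.

Definition created (t : nat) (p : ipair n) : bool :=
  simple p || (creation_time (snd_ix p) (fst_ix p) < t)%N.

(* The terms of [ordered_form] headed by those p whose merge with the next simple
   root precedes t; the others are not yet present in the exponent. *)
Definition partial_form (t : nat) (m : mtuple n) : nat :=
  (\sum_(p : ipair n | creation_time (snd_ix p).+1 (fst_ix p) < t)
     m p * \sum_(r : ipair n | above p r) m r)%N.

(** Just after ga is created, any r above al other than si ends later than ga, or ends with it and
    has larger rank; so r is not yet created and has multiplicity 0. *)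
Lemma above_simple (al si ga : ipair n) (m : mtuple n) :
  fst_ix ga = fst_ix al -> fst_ix si = snd_ix al ->
  snd_ix si = (snd_ix al).+1 -> snd_ix ga = (snd_ix al).+1 ->
  supported (created (creation_time (snd_ix ga) (fst_ix ga)).+1) m ->
  (\sum_(r | above al r) m r = m si)%N.
Proof.
move=> ga1 si1 si2 ga2 /supportedP sm.
have al12 := ipair_lt al.
have si_ab : above al si.
  by rewrite /above si1 si2 ltnSn leqnn rho_lt.
rewrite (bigD1 si) //= big1 ?addn0 // => r /andP[rab rsi].
apply: sm; rewrite /created negb_or.
have r12 := ipair_lt r; have rn := snd_ix_lt r; have gan := snd_ix_lt ga.
move: rab => /and3P[h1 h2 h3].
have fst_lt : (snd_ix r == (snd_ix al).+1) -> (fst_ix r < snd_ix al)%N.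
  move=> /eqP e; rewrite ltn_neqAle h2 andbT; apply: contraNneq rsi => e'.
  by apply/eqP/ipair_inj; rewrite ?e ?e'.
apply/andP; split; first by rewrite /simple; lia.
rewrite -leqNgt creation_time_lt ?ga1 ?ga2 /=; lia.
Qed.

Section Step.
Variables (L : seq (mtuple n)) (k : {ffun 'I_n.-1 -> nat}).
Hypotheses (uL : uniq L) (memL : forall m, (m \in L) = (lambda m == k)).

Let partial_sum t := \sum_(m <- L | supported (created t) m)
  qweight (partial_form t m) m.

(** At most one non-simple root ga = (i, j) is created at time t. If there is one, the pentagon move
    applies with al = (i, j - 1) and si = (j - 1, j); otherwise neither range nor exponent
    changes. *)
Lemma partial_sumS t : partial_sum t.+1 = partial_sum t.
Proof.
case: (pickP [pred ga : ipair n |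
    ~~ simple ga && (creation_time (snd_ix ga) (fst_ix ga) == t)]); last first.
  move=> noga.
  have createdE : created t.+1 =1 created t.
    move=> p; rewrite /created; have /= := noga p; case: (simple p) => //=.
    by rewrite ltnS leq_eqVlt => ->.
  rewrite /partial_sum; apply: eq_big => m.
    by apply: eq_forallb => p; rewrite createdE.
  move=> _; congr qweight; rewrite /partial_form.
  rewrite [LHS]big_mkcond [RHS]big_mkcond; apply: eq_bigr => p _.
  rewrite ltnS leq_eqVlt; case: eqP => //= pt; rewrite pt ltnn.
  (* If some r lay above p, the root with the start of p and the next end would exist and be created
     at time t. *)
  rewrite big1 ?muln0 // => r /andP[pr _].
  have [ga g1 g2] := @ipair_exists n (fst_ix p) (snd_ix p).+1
    (leqW (ipair_lt p)) (leq_ltn_trans pr (snd_ix_lt r)).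
  have /= := noga ga; rewrite g1 g2 pt eqxx andbT /simple g1 g2.
  by have := ipair_lt p; lia.
move=> ga /andP[nsga /eqP gat].
have gan := snd_ix_lt ga; have ga12 := ipair_lt ga.
move: nsga; rewrite /simple => nsga.
have [al al1 al2] := @ipair_exists n (fst_ix ga) (snd_ix ga).-1
  ltac:(lia) ltac:(lia).
have [si si1 si2] := @ipair_exists n (snd_ix ga).-1 (snd_ix ga)
  ltac:(lia) ltac:(lia).
have al_si : al != si by apply/eqP => e; move: al2; rewrite e; lia.
have al_ga : al != ga by apply/eqP => e; move: al2; rewrite e; lia.
have si_ga : si != ga by apply/eqP => e; move: si1; rewrite e; lia.
apply: (sum_merge al_si al_ga si_ga) => //.
(* The interval of ga is the disjoint union of those of al and si, so [lambda] is invariant. *)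
- move=> m; rewrite !memL; congr (_ == _).
  apply/ffunP => i; rewrite !ffunE; apply: sum_merge_pred => //.
  by rewrite al1 al2 si1 si2; lia.
- rewrite /created -gat creation_time_lt; last by lia.
    by rewrite al2; lia.
  by rewrite al1 al2; lia.
- by rewrite /created /simple si1 si2; lia.
- by rewrite /created /simple gat ltnn orbF.
- move=> p; rewrite /created ltnS leq_eqVlt -orbA; congr (_ || _).
  rewrite orbC; congr (_ || _).
  apply/eqP/eqP => [pt|->//].
  have := snd_ix_lt p; have := ipair_lt p => p12 pn.
  by case: (creation_time_inj _ _ (etrans pt (esym gat))); last exact: ipair_inj; lia.
(* The exponent gains one row, headed by al, which contributes m al * m si by [above_simple]. The
   other rows must be invariant under [merge]. *)
move=> m sm; rewrite /partial_form (bigD1 al) /=; last first.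
  by rewrite al1 al2 -gat prednK ?ltnS //; lia.
rewrite addnC (@above_simple al si ga) ?gat // ?al1 ?al2 ?si1 ?si2 ?prednK //; try lia.
congr (_ + _)%N; apply: eq_big => [p|p /andP[pt pal]].
  have := snd_ix_lt p; have := ipair_lt p => p12 pn.
  rewrite ltnS leq_eqVlt -gat.
  case: (creation_time _ _ =P creation_time _ _) => /= [e|_].
    have [||e1 e2] := creation_time_inj _ _ e; try lia.
    rewrite e ltnn; apply/negbTE; rewrite negbK; apply/eqP/ipair_inj; lia.
  case: (p =P al) => [->|_]; last by rewrite andbT.
  by rewrite al1 al2 prednK ?ltnn //; lia.
have := snd_ix_lt p; have := ipair_lt p => p12 pn.
have {}pt : (snd_ix p < (snd_ix ga).-1)%N || (snd_ix p == (snd_ix ga).-1) &&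
    (rho (snd_ix p) (fst_ix p) < rho (snd_ix p) (fst_ix ga))%N.
  move: pt; rewrite ltnS leq_eqVlt -gat => /orP[/eqP e|].
    have [||e1 e2] := creation_time_inj _ _ e; try lia.
    by case/eqP: pal; apply: ipair_inj; lia.
  by rewrite creation_time_lt /=; lia.
congr (_ * _)%N.
  rewrite ffunE; case: eqP => [pga|_]; first by move: pt; rewrite pga; lia.
  rewrite (negPf pal); case: eqP => // psi; move: pt; rewrite psi si1 si2; lia.
(* If p ends before al, then ga is above p exactly when al is, and si is not. If p ends with al,
   then si and ga are above p and al is not. *)
apply/esym/sum_merge_pred => //.
rewrite /above al1 al2 si1 si2.
case/orP: pt => [pv|/andP[/eqP pv pr]].
  by lia.
have := @rho_lt (snd_ix p) (fst_ix p) p12.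
rewrite -pv; lia.
Qed.

End Step.
End OrderedForm.

(** * Simple roots, the starting point of the creation process *)

Section SimpleRoots.
Variable n : nat.

Lemma simple_root_subproof (i : 'I_n.-1) : (i.+1 < n)%N.
Proof. by case: i => i /= h; lia. Qed.

Definition simple_root (i : 'I_n.-1) : ipair n :=
  Sub (Ordinal (ltnW (simple_root_subproof i)),
       Ordinal (simple_root_subproof i)) (ltnSn i).

Lemma simple_root_inj : injective simple_root.
Proof. by move=> i j e; apply/val_inj/(congr1 (@fst_ix n) e). Qed.

Lemma simpleE (p : ipair n) : simple p = (p \in simple_root @: 'I_n.-1).
Proof.
apply/idP/imsetP => [/eqP sp|[i _ ->]]; last exact: eqxx.
have pn : (fst_ix p < n.-1)%N by have := snd_ix_lt p; lia.
exists (Ordinal pn); first by rewrite inE.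
by apply: ipair_inj; rewrite ?sp.
Qed.

Lemma simple_simple_root i : simple (simple_root i).
Proof. exact: eqxx. Qed.

Lemma lambda_simple (m : mtuple n) i : supported (@simple n) m ->
  lambda m i = m (simple_root i).
Proof.
move=> /supportedP sm; rewrite ffunE (bigD1 (simple_root i)) /=; last first.
  by rewrite /fst_ix /snd_ix /= leqnn ltnSn.
rewrite big1 ?addn0 // => p /andP[/andP[h1 h2] pi]; apply: sm.
apply: contraNN pi => /eqP sp; apply/eqP/ipair_inj.
  by rewrite /= {2}/fst_ix /=; lia.
by rewrite {2}/snd_ix /=; lia.
Qed.

Lemma prod_qpoch_simple (m : mtuple n) : supported (@simple n) m ->
  \prod_p qpoch (m p) = \prod_(i < n.-1) qpoch (lambda m i).
Proof.
move=> sm; rewrite (bigID (@simple n)) /= [X in _ * X]big1 ?mulr1; last first.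
  move=> p /(supportedP _ _ sm) ->; by rewrite /qpoch big_geq.
rewrite (eq_bigl _ _ simpleE) big_imset /=; last by move=> i j _ _ /simple_root_inj.
by apply: eq_bigr => i _; rewrite lambda_simple.
Qed.

Definition simple_mtuple (k : {ffun 'I_n.-1 -> nat}) : mtuple n :=
  [ffun p => (\sum_(i < n.-1 | simple_root i == p) k i)%N].

Lemma simple_mtupleE k i : simple_mtuple k (simple_root i) = k i.
Proof.
rewrite ffunE (bigD1 i) //= big1 ?addn0 // => j /andP[/eqP/simple_root_inj->].
by rewrite eqxx.
Qed.

Lemma supported_simple_mtuple k : supported (@simple n) (simple_mtuple k).
Proof.
apply/supportedP => p; rewrite ffunE => nsp; rewrite big1 // => i /eqP pE.
by move: nsp; rewrite -pE simple_simple_root.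
Qed.

Lemma simple_mtuple_uniq (m : mtuple n) : supported (@simple n) m ->
  simple_mtuple (lambda m) = m.
Proof.
move=> sm; apply/ffunP => p; have [sp|nsp] := boolP (simple p).
  by move: sp; rewrite simpleE => /imsetP[i _ ->]; rewrite simple_mtupleE lambda_simple.
by rewrite (supportedP _ _ (supported_simple_mtuple _)) // (supportedP _ _ sm).
Qed.

End SimpleRoots.

(** Beyond all creation times every root is present and [partial_form] is [ordered_form]. Descending
    to time 0 by [partial_sumS] leaves exponent 0 and the single tuple on simple roots determined by
    k. *)
Lemma sum_ordered_form n (rho : nat -> nat -> nat)
    (L : seq (mtuple n)) (k : {ffun 'I_n.-1 -> nat}) :
  (forall j i a, (i <= j)%N -> (a <= j)%N -> rho j i = rho j a -> i = a) ->
  (forall j i, (i < j)%N -> (rho j i < rho j j)%N) ->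
  (forall j, (rho j j <= j.+1)%N) ->
  uniq L -> (forall m, (m \in L) = (lambda m == k)) ->
  \sum_(m <- L) qweight (ordered_form rho m) m = (\prod_i qpoch (k i))^-1.
Proof.
move=> rho_inj rho_lt rho_le uL memL.
pose T := (n.+1 * n.+2)%N.
transitivity (\sum_(m <- L | supported (created rho T) m)
    qweight (partial_form rho T m) m).
  have bound := creation_time_bound rho_lt rho_le.
  apply: eq_big => [m|m _].
    apply/esym/supportedP => p; rewrite /created bound ?orbT //.
    by have := ipair_lt p; have := snd_ix_lt p; lia.
  congr qweight; rewrite /partial_form /ordered_form; apply: eq_big => [p|p _].
    by rewrite bound //; have := ipair_lt p; have := snd_ix_lt p; lia.
  by rewrite big_distrr.
elim: T => [|t IHt]; last by rewrite (partial_sumS _ _ _ uL memL).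
have created0 : created rho 0 =1 @simple n by move=> p; rewrite /created orbF.
have supp0 m : supported (created rho 0) m = supported (@simple n) m.
  by apply: eq_forallb => p; rewrite created0.
rewrite (eq_bigl _ _ supp0).
rewrite -big_filter (perm_big [:: simple_mtuple k]); last first.
  apply: uniq_perm; rewrite ?filter_uniq // => m.
  rewrite mem_filter memL inE; apply/andP/eqP => [[sm /eqP<-]|->].
    by rewrite simple_mtuple_uniq.
  split; first exact: supported_simple_mtuple.
  apply/eqP/ffunP => i; rewrite lambda_simple ?simple_mtupleE //.
  exact: supported_simple_mtuple.
rewrite big_seq1 /qweight /partial_form big_pred0 // expr0 mul1r.
rewrite prod_qpoch_simple ?supported_simple_mtuple //; congr _^-1.
apply: eq_bigr => i _; rewrite lambda_simple ?supported_simple_mtuple //.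
by rewrite simple_mtupleE.
Qed.

(** * Summability and coefficient extraction *)

Lemma finite_lambda_fiber n (k : {ffun 'I_n.-1 -> nat}) :
  finite_set [set m : mtuple n | lambda m = k].
Proof.
pose K := (\sum_i k i)%N.
pose emb (g : {ffun ipair n -> 'I_K.+1}) : mtuple n := [ffun p => g p : nat].
apply: (@sub_finite_set _ _ (emb @` setT)); last first.
  exact: finite_image.
move=> m /= mk; exists [ffun p => inord (m p)] => //.
apply/ffunP => p; rewrite !ffunE inordK // ltnS.
have pn : (fst_ix p < n.-1)%N by have := snd_ix_lt p; have := ipair_lt p; lia.
(* The root p = (i, j) contributes to [lambda] at i, so m p <= k i <= K. *)
apply: (@leq_trans (k (Ordinal pn))); last first.
  by rewrite /K (bigD1 (Ordinal pn)) //= leq_addr.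
by rewrite -mk ffunE (bigD1 p) ?leq_addr //= leqnn ipair_lt.
Qed.

Lemma fcoef_sum (R : comUnitRingType) (I : Type) (s : seq I) (F : I -> fps R) a :
  fcoef (\sum_(i <- s) F i) a = \sum_(i <- s) fcoef (F i) a.
Proof. by elim: s => [|i s IHs]; rewrite ?big_nil // !big_cons fcoefD IHs. Qed.

Lemma k_term_summable d : xsummable (@k_term d).
Proof.
move=> e a; apply: (@sub_finite_set _ _ [set e]); last exact: finite_set1.
move=> k /=; rewrite /k_term /xmonom.
by case: (e =P k) => [->//|_]; rewrite fcoef0 eqxx.
Qed.

Lemma m_term_summable n (Q : mtuple n -> nat) : xsummable (m_term Q).
Proof.
move=> e a; apply: sub_finite_set (finite_lambda_fiber e) => m /=.
by rewrite /m_term /xmonom; case: (e =P _) => [->//|_]; rewrite fcoef0 eqxx.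
Qed.

Lemma xsum_k_term d (k : {ffun 'I_d -> nat}) :
  xsum (@k_term d) k = qvar ^+ half_cartan_form k / \prod_(i < d) qpoch (k i).
Proof.
apply: fpsP => a /=.
rewrite (fsbigE [:: k]) // => [|i _].
  by rewrite big_cons big_nil in_setT /= addr0 /k_term /xmonom eqxx.
by rewrite inE /k_term /xmonom eq_sym => /negPf ->.
Qed.

Lemma xsum_m_term n (Q : mtuple n -> nat) (k : {ffun 'I_n.-1 -> nat})
    (L : seq (mtuple n)) :
  uniq L -> (forall m, (m \in L) = (lambda m == k)) ->
  xsum (m_term Q) k = \sum_(m <- L) qweight (Q m) m.
Proof.
move=> uL memL; apply: fpsP => a; rewrite fcoef_sum /=.
rewrite (fsbigE L) // => [|m _].
  rewrite big_seq_cond [RHS]big_seq; apply: eq_big => m; first by rewrite in_setT andbT.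
  by rewrite memL => /andP[/eqP mk _]; rewrite /m_term /xmonom mk eqxx.
by rewrite memL /m_term /xmonom eq_sym => /negPf ->.
Qed.

(** * The quadratic forms *)

Lemma Posz_sum (I : Type) (s : seq I) (P : pred I) (F : I -> nat) :
  (\sum_(i <- s | P i) F i)%N%:Z = \sum_(i <- s | P i) (F i)%:Z.
Proof. exact: (big_morph Posz PoszD). Qed.

Lemma sum_ord_pick d (b : nat) (F : nat -> int) :
  \sum_(v < d) F v * (b == v.+1)%:Z = (0 < b <= d)%:Z * F b.-1.
Proof.
elim: d => [|d IHd]; first by rewrite big_ord0; case: b => [|b]; rewrite /= mul0r.
rewrite big_ord_recr /= IHd; case: (b =P d.+1) => [->|bd] /=.
  by rewrite ltnn leqnn mulr1 mul0r mul1r add0r.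
rewrite mulr0 addr0; congr (_%:Z * _); congr nat_of_bool; lia.
Qed.

(** The Cartan matrix is D + D^T with D the identity minus the shift, and both halves give the same
    sum. The convention K d = 0 covers the last row of D. *)
Lemma cartan_form_shift d (k : {ffun 'I_d -> nat}) (K : nat -> int) :
  (forall i : 'I_d, (k i)%:Z = K i) -> K d = 0 ->
  cartan_form k = 2 * \sum_(i < d) K i * (K i - K i.+1).
Proof.
move=> kK Kd; pose D (i j : nat) : int := (i == j)%:Z - (i.+1 == j)%:Z.
have DE (i : 'I_d) : \sum_(j < d) D i j * K j = K i - K i.+1.
  transitivity (\sum_(j < d) (K j * (i.+1 == j.+1)%:Z - K j * (i.+2 == j.+1)%:Z)).
    by apply: eq_bigr => j _; rewrite /D !eqSS; ring.
  rewrite sumrB !sum_ord_pick /= ltn_ord mul1r.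
  have := ltn_ord i; rewrite leq_eqVlt => /orP[/eqP e|->]; last by rewrite mul1r.
  by rewrite e ltnn Kd mulr0.
transitivity (\sum_(i < d) \sum_(j < d) (K i * (D i j * K j) + K j * (D j i * K i))).
  rewrite cartan_formE; apply: eq_bigr => i _; apply: eq_bigr => j _.
  rewrite !kK mxE /D -val_eqE /= (eq_sym (j : nat) i).
  case: (ltngtP i j) => //= ij; rewrite ?(gtn_eqF (ltnW ij)) /=.
  - by rewrite (_ : (j.+1 == i) = false) ?orbF; [case: eqP => _ /=; ring | lia].
  - by rewrite (_ : (i.+1 == j) = false) /=; [case: eqP => _ /=; ring | lia].
  - by rewrite ij (_ : (j.+1 == j :> nat) = false) /=; [ring | lia].
under eq_bigr do rewrite big_split /=.
rewrite big_split /= [X in _ + X]exchange_big /= -mulr2n mulr_natl.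
by congr (_ *+ 2); apply: eq_bigr => i _; rewrite -mulr_sumr DE.
Qed.

(** With multiplicities, K v counts the intervals containing v, so K v - K v.+1 counts those ending
    at v + 1 minus those starting there; this is then summed over v in the interval of p. *)
Lemma half_cartan_form_lambda n (m : mtuple n) :
  (half_cartan_form (lambda m))%:Z = \sum_(p : ipair n) \sum_(r : ipair n)
    (m p * m r)%:Z * ((fst_ix p < snd_ix r <= snd_ix p)%:Z
                      - (fst_ix p < fst_ix r <= snd_ix p)%:Z).
Proof.
pose K (v : nat) : int :=
  \sum_(p : ipair n) (fst_ix p <= v < snd_ix p)%:Z * (m p)%:Z.
have Kd : K n.-1 = 0.
  rewrite /K big1 // => p _; rewrite (_ : _ && _ = false) ?mul0r //.
  by have := snd_ix_lt p; lia.
have kK i : (lambda m i)%:Z = K i.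
  rewrite ffunE /K Posz_sum big_mkcond; apply: eq_bigr => p _.
  by case: ifP => _; rewrite ?mul1r ?mul0r.
have KB v : K v - K v.+1 = \sum_(r : ipair n)
    (m r)%:Z * ((snd_ix r == v.+1)%:Z - (fst_ix r == v.+1)%:Z).
  rewrite /K -sumrB; apply: eq_bigr => r _; have := ipair_lt r => r12.
  by rewrite -mulrBl mulrC; congr (_ * _); lia.
apply: (@mulIf _ 2) => //; rewrite half_cartan_formE (cartan_form_shift kK Kd) mulrC.
congr (_ * _); under eq_bigr do rewrite KB {1}/K mulr_suml.
rewrite exchange_big; apply: eq_bigr => p _ /=.
under eq_bigr do rewrite mulr_sumr.
rewrite exchange_big; apply: eq_bigr => r _ /=.
pose F v : int := (fst_ix p <= v < snd_ix p)%:Z.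
transitivity ((m p * m r)%:Z *
   (\sum_(v < n.-1) F v * (snd_ix r == v.+1)%:Z
    - \sum_(v < n.-1) F v * (fst_ix r == v.+1)%:Z)).
  rewrite -sumrB mulr_sumr; apply: eq_bigr => v _; rewrite PoszM /F; ring.
rewrite !sum_ord_pick /F.
have := ipair_lt r; have := snd_ix_lt p => pn r12.
by congr (_ * (_ - _)); lia.
Qed.

Lemma sum_pairs (P : finType) (Q : rel P) (m : P -> nat) :
  (\sum_p \sum_(r | Q p r) m p * m r)%N%:Z =
  \sum_p \sum_r (m p * m r)%:Z * (Q p r)%:Z.
Proof.
rewrite Posz_sum; apply: eq_bigr => p _.
rewrite Posz_sum big_mkcond; apply: eq_bigr => r _.
by case: ifP => _; rewrite ?mulr1 ?mulr0.
Qed.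

(** Exchanging p and r negates the sum. Quadratic forms can thus be compared through symmetrised
    coefficients. *)
Lemma sum_pairs_antisym (P : finType) (g : P -> P -> int) (m : P -> nat) :
  (forall p r, g p r + g r p = 0) ->
  \sum_p \sum_r (m p * m r)%:Z * g p r = 0.
Proof.
move=> gN; apply: (@mulfI _ 2) => //; rewrite mulr0 mulr_natl mulr2n.
rewrite {2}exchange_big -big_split big1 // => p _ /=.
rewrite -big_split big1 // => r _ /=.
by rewrite mulnC -mulrDr gN mulr0.
Qed.

Lemma Bform'_ordered n (m : mtuple n) : Bform' m =
  (ordered_form (fun _ i => i) m + half_cartan_form (lambda m))%N.
Proof.
apply/eqP; rewrite -eqz_nat PoszD half_cartan_form_lambda.
rewrite /Bform' /ordered_form !sum_pairs -subr_eq0 opprD addrA -!sumrB.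
under eq_bigr do rewrite -!sumrB.
under eq_bigr do under eq_bigr do rewrite -!mulrBr.
apply/eqP/sum_pairs_antisym => p r; rewrite /above.
have := ipair_lt p; have := ipair_lt r.
move: (fst_ix p) (snd_ix p) (fst_ix r) (snd_ix r) => i j a b ab ij.
by lia.
Qed.

(* For [Bform'] the merges with ending point j are done for i = 0, 1, ..., j - 1;
   for [Bform] the case i = j - 1 is moved to the front. *)
Definition simple_first (j i : nat) : nat := if i.+1 == j then 0%N else i.+1.

Lemma Bform_ordered n (m : mtuple n) : Bform m =
  (ordered_form simple_first m + half_cartan_form (lambda m))%N.
Proof.
apply/eqP; rewrite -eqz_nat PoszD half_cartan_form_lambda.
(* Moving the condition on p into the inner range gives the last sum the shape required by
   [sum_pairs]. *)
rewrite /Bform [X in (_ + X)%N](_ : _ = \sum_(p : ipair n) \sum_(r : ipair n |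
   [&& snd_ix p == (fst_ix p).+1, fst_ix r < fst_ix p & (fst_ix p).+1 < snd_ix r])
   m p * m r)%N; last first.
  rewrite big_mkcond; apply: eq_bigr => p _; case: eqP => //= _.
  by rewrite big_pred0.
rewrite !PoszD /ordered_form !sum_pairs -subr_eq0 opprD addrA -!big_split /= -!sumrB.
under eq_bigr do rewrite -!big_split /= -!sumrB.
under eq_bigr do under eq_bigr do rewrite -!mulrDr -!mulrBr.
apply/eqP/sum_pairs_antisym => p r; rewrite /above /simple_first.
have := ipair_lt p; have := ipair_lt r.
move: (fst_ix p) (snd_ix p) (fst_ix r) (snd_ix r) => i j a b ab ij.
rewrite [j == i.+1]eq_sym [b == a.+1]eq_sym.
case: (ltngtP i a) => ia; case: (ltngtP j b) => jb /=.
all: case: (i.+1 =P j) => h1; case: (a.+1 =P b) => h2; try lia.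
all: by case: (i.+1 =P b) => h3; case: (a.+1 =P j) => h4 /=; lia.
Qed.

(** * Comparison of coefficients and conclusion *)

Lemma xsum_m_term_ordered n (rho : nat -> nat -> nat) (Q : mtuple n -> nat) :
  (forall j i a, (i <= j)%N -> (a <= j)%N -> rho j i = rho j a -> i = a) ->
  (forall j i, (i < j)%N -> (rho j i < rho j j)%N) ->
  (forall j, (rho j j <= j.+1)%N) ->
  (forall m, Q m = (ordered_form rho m + half_cartan_form (lambda m))%N) ->
  xsum (m_term Q) = xsum (@k_term n.-1).
Proof.
move=> rho_inj rho_lt rho_le QE; apply/funext => k; rewrite xsum_k_term.
have /finite_seqP[L LE] := finite_lambda_fiber k.
have memL m : (m \in undup L) = (lambda m == k).
  rewrite mem_undup; apply/idP/eqP => [mL|mk].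
    by have : [set m' | lambda m' = k]%classic m by rewrite LE.
  by have : [set` L]%classic m by rewrite -LE.
rewrite (xsum_m_term _ (undup_uniq L) memL).
rewrite -(sum_ordered_form rho_inj rho_lt rho_le (undup_uniq L) memL).
(* On the fibre over k the half Cartan form is constant, so its power of q factors out. *)
rewrite mulr_sumr big_seq [RHS]big_seq; apply: eq_bigr => m.
by rewrite memL => /eqP mk; rewrite /qweight QE mk addnC exprD mulrA.
Qed.

Theorem theorem1p1 (n : nat) (hn : (2 <= n)%N) :
  [/\ xsummable (m_term (@Bform n)),
      xsummable (@k_term n.-1)
    & xsum (m_term (@Bform n)) = xsum (@k_term n.-1)]
  /\
  [/\ xsummable (m_term (@Bform' n)),
      xsummable (@k_term n.-1)
    & xsum (m_term (@Bform' n)) = xsum (@k_term n.-1)].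
Proof.
split; split; try exact: m_term_summable; try exact: k_term_summable.
  apply: (@xsum_m_term_ordered n simple_first _ _ _ _ (@Bform_ordered n)).
  - by move=> j i a; rewrite /simple_first; do 2 case: eqP; lia.
  - by move=> j i ij; rewrite /simple_first; do 2 case: eqP; lia.
  - by move=> j; rewrite /simple_first; case: eqP; lia.
by apply: (@xsum_m_term_ordered n (fun _ i => i) _ _ _ _ (@Bform'_ordered n)).
Qed.
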